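(* Let $\mathbb{K}$ be a field, let $I$ be a squarefree monomial ideal in $R=\mathbb{K}[x_1,\dots,x_n]$, and suppose that the facet complex of $I$ contains no simplicial even walk. Then $I$ is of linear type.
   Context: Let $I=(f_1,\dots,f_q)$ be a squarefree monomial ideal with minimal monomial generators $f_1,\dots,f_q$. Its facet complex is the simplicial complex $\langle F_1,\dots,F_q\rangle$ with facets $F_i=\{x_j : x_j\mid f_i\}$. The Rees algebra of $I$ is $R[It]=R[f_1t,\dots,f_qt]$. Let $S=R[T_1,\dots,T_q]$ and let $J$ (the defining ideal) be the kernel of the $R$-algebra map $S\to R[It]$, $T_i\mapsto f_it$. $J$ is graded by degree in the $T_i$; $I$ is of linear type if $J$ is generated by its elements that are homogeneous of degree $1$ in $T_1,\dots,T_q$. Simplicial even walks. Let $\Delta=\langle F_1,\dots,F_q\rangle$ be a simplicial complex with (distinct) facets $F_1,\dots,F_q$ and vertex set $V(\Delta)$. For $s\ge 1$ let $\mathcal{I}_s=\{(i_1,\dots,i_s): 1\le i_1\le\cdots\le i_s\le q\}$. For $\alpha=(i_1,\dots,i_s)\in\mathcal{I}_s$ put $\mathrm{Supp}(\alpha)=\{i_1,\dots,i_s\}$, and for a vertex $x$ let $\deg_\alpha(x)=\max\{m : x^m\mid f_{i_1}\cdots f_{i_s}\}$, where $f_i=\prod_{x\in F_i}x$; i.e. $\deg_\alpha(x)$ is the number of positions $t$ with $x\in F_{i_t}$. For $s\ge2$, $\alpha=(i_1,\dots,i_s)$ and $\beta=(j_1,\dots,j_s)$ in $\mathcal{I}_s$,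 the sequence of not necessarily distinct facets $\mathcal{C}_{\alpha,\beta}=F_{i_1},F_{j_1},\dots,F_{i_s},F_{j_s}$ is a simplicial even walk if for every $i\in\mathrm{Supp}(\alpha)$ and $j\in\mathrm{Supp}(\beta)$ we have $F_i\setminus F_j\not\subseteq\{x\in V(\Delta):\deg_\alpha(x)>\deg_\beta(x)\}$ and $F_j\setminus F_i\not\subseteq\{x\in V(\Delta):\deg_\alpha(x)<\deg_\beta(x)\}$. $\Delta$ contains a simplicial even walk if such $s\ge2$ and $\alpha,\beta\in\mathcal{I}_s$ exist. *)

(* Defs.v *)
From mathcomp Require Import all_boot all_order all_algebra.
From mathcomp Require Export mpoly.

Set Implicit Arguments.
Unset Strict Implicit.
Unset Printing Implicit Defensive.

Import GRing.Theory.
Local Open Scope ring_scope.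

Section Ideals.
Variable A : comNzRingType.

(* The ideal generated by G, as the set of finite A-linear combinations
   (c, g) |-> \sum c * g of elements g of G. *)
Definition ideal_gen (G : A -> Prop) (p : A) : Prop :=
  exists s : seq (A * A),
    (forall c, c \in s -> G c.2) /\ p = \sum_(c <- s) c.1 * c.2.

Definition generates (G I : A -> Prop) : Prop :=
  forall p, I p <-> ideal_gen G p.

(* S = A[T_1, ..., T_q] -> A[t], T_i |-> f_i t.  The image is the Rees algebra
   A[f_1 t, ..., f_q t], so restricting the codomain does not change the
   kernel. *)
Definition rees_map q (f : 'I_q -> A) (p : {mpoly A[q]}) : {poly A} :=
  mmap (@polyC A) (fun i => (f i)%:P * polyX A) p.

Definition defining_ideal q (f : 'I_q -> A) (p : {mpoly A[q]}) : Prop :=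
  rees_map f p = 0.

End Ideals.

(* Linear type of the ideal (f_1, ..., f_q).  The grading is the one by
   degree in the T_i: elements of A have degree 0. *)
Definition linear_type (A : comNzRingType) q (f : 'I_q -> A) : Prop :=
  generates (fun p : {mpoly A[q]} => defining_ideal f p /\ p \is 1.-homog)
            (defining_ideal f).

Section MonomialIdeals.
Variables (K : fieldType) (n : nat).

Definition squarefree_mnm (m : 'X_{1..n}) : Prop := forall j, (m j <= 1)%N.

Definition squarefree_monomial_ideal (I : {mpoly K[n]} -> Prop) : Prop :=
  exists M : 'X_{1..n} -> Prop,
    (forall m, M m -> squarefree_mnm m) /\
    generates (fun p => exists2 m, M m & p = 'X_[m]) I.

(* The monomials 'X_[m i] generate I and none of them can be omitted; in
   particular they are pairwise distinct. *)
Definition minimal_monomial_generators q (I : {mpoly K[n]} -> Prop)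
    (m : 'I_q -> 'X_{1..n}) : Prop :=
  generates (fun p => exists i, p = 'X_[m i]) I /\
  forall i, ~ generates (fun p => exists2 j, j != i & p = 'X_[m j]) I.

End MonomialIdeals.

(* (U_(j) <= m i)%MM says that x_j divides the monomial 'X_[m i]. *)
Definition facet n q (m : 'I_q -> 'X_{1..n}) (i : 'I_q) : {set 'I_n} :=
  [set j | (U_(j) <= m i)%MM].

(* A simplicial complex is given by the family F of its facets. *)
Section EvenWalks.
Variables (V : finType) (q : nat) (F : 'I_q -> {set V}).

Definition vertices : {set V} := \bigcup_i F i.

Definition index_seq s (a : s.-tuple 'I_q) : bool :=
  sorted (fun i j : 'I_q => (i <= j)%N) a.

(* Exponent of x in the product of the monomials \prod_(y in F i) y, i in a. *)
Definition deg s (a : s.-tuple 'I_q) (x : V) : nat :=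
  count (fun i => x \in F i) a.

(* Supp(a) is the set of entries of the tuple a. *)
Definition simplicial_even_walk s (a b : s.-tuple 'I_q) : Prop :=
  forall i j, i \in a -> j \in b ->
    ~~ (F i :\: F j \subset [set x in vertices | (deg b x < deg a x)%N]) /\
    ~~ (F j :\: F i \subset [set x in vertices | (deg a x < deg b x)%N]).

Definition contains_simplicial_even_walk : Prop :=
  exists s (a b : s.-tuple 'I_q),
    [/\ (2 <= s)%N, index_seq a, index_seq b & simplicial_even_walk a b].

End EvenWalks.

(* Main.v *)
(* Modulo the ideal L generated by the linear elements of J, two monomials
   x^a T^u and x^b T^v with the same image in R[It] are congruent, by induction
   on |u| = |v|.  As (u, v) is not an even walk, there are i in Supp(u) and j in
   Supp(v) with, up to symmetry, F_i \ F_j inside {deg_u > deg_v}.  Equality of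
   the images makes b positive on that set, so T_j may be exchanged for T_i in
   x^b T^v modulo L; both monomials are then divisible by T_i, which cancels.
   An element of J is a combination of differences of monomials with the same
   image, hence lies in L. *)
Require Import Defs.
From mathcomp Require Import all_boot all_order all_algebra.
From mathcomp Require Import zify.

Set Implicit Arguments.
Unset Strict Implicit.
Unset Printing Implicit Defensive.

Import GRing.Theory.
Local Open Scope ring_scope.

Lemma sum_fibers (V : nmodType) (T U : eqType) (h : T -> U) (t : seq T)
    (F : T -> V) :
  \sum_(k <- t) F k =
  \sum_(z <- undup [seq h k | k <- t]) \sum_(k <- t | h k == z) F k.
Proof.
rewrite (exchange_big_dep xpredT) //= [LHS]big_seq [RHS]big_seq.
apply: eq_bigr => k kt.
rewrite big_mkcond (bigD1_seq (h k)) ?undup_uniq ?mem_undup ?map_f //= eqxx.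
by rewrite big1 ?addr0 // => z; rewrite eq_sym => /negPf ->.
Qed.

(** * Closure properties of generated ideals *)

Section IdealGen.
Variables (A : comNzRingType) (G : A -> Prop).

Lemma ideal_gen_in p : G p -> ideal_gen G p.
Proof.
move=> Gp; exists [:: (1, p)]; split; last by rewrite big_seq1 mul1r.
by move=> c; rewrite inE => /eqP ->.
Qed.

Lemma ideal_gen0 : ideal_gen G 0.
Proof. by exists [::]; rewrite big_nil. Qed.

Lemma ideal_genD p1 p2 :
  ideal_gen G p1 -> ideal_gen G p2 -> ideal_gen G (p1 + p2).
Proof.
move=> [s1 [Gs1 ->]] [s2 [Gs2 ->]]; exists (s1 ++ s2); rewrite big_cat.
by split=> // c; rewrite mem_cat => /orP[/Gs1|/Gs2].
Qed.

Lemma ideal_genM r p : ideal_gen G p -> ideal_gen G (r * p).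
Proof.
move=> [s [Gs ->]]; exists [seq (r * c.1, c.2) | c <- s]; split.
  by move=> c /mapP[d /Gs ? ->].
by rewrite big_map mulr_sumr; apply: eq_bigr => c _; rewrite mulrA.
Qed.

Lemma ideal_genN p : ideal_gen G p -> ideal_gen G (- p).
Proof. by rewrite -mulN1r; apply: ideal_genM. Qed.

Lemma ideal_gen_sum (T : eqType) (s : seq T) (f : T -> A) :
  (forall x, x \in s -> ideal_gen G (f x)) -> ideal_gen G (\sum_(x <- s) f x).
Proof.
move=> Gf; rewrite big_seq; apply: (big_ind (ideal_gen G)) => //.
- exact: ideal_gen0.
- exact: ideal_genD.
Qed.

End IdealGen.

Lemma ideal_gen_sub (A : comNzRingType) (G H : A -> Prop) p :
  (forall g, G g -> ideal_gen H g) -> ideal_gen G p -> ideal_gen H p.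
Proof.
move=> GH [s [Gs ->]]; apply: ideal_gen_sum => c cs.
exact/ideal_genM/GH/Gs.
Qed.

(** * Divisibility in monomial ideals *)

Section MonomialIdealMembership.
Variables (K : fieldType) (n : nat).

(** The coefficient 1 of ['X_[w]] must come from some summand, and every monomial in the support of
    a multiple of ['X_[w']] is divisible by ['X_[w']]. *)
Lemma ideal_genX_dvd (G : {mpoly K[n]} -> Prop) (M : 'X_{1..n} -> Prop) w :
  (forall p, G p -> exists2 w', M w' & p = 'X_[w']) ->
  ideal_gen G 'X_[w] -> exists2 w', M w' & (w' <= w)%MM.
Proof.
move=> GM [s [Gs /(congr1 (mcoeff w))]].
rewrite mcoeffX eqxx raddf_sum /= big_seq => sum1.
have /hasP[c cs nz] : has (fun c => (c.1 * c.2)@_w != 0) s.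
  apply: contra_eqT sum1; rewrite -all_predC => /allP s0.
  by rewrite big1 ?oner_neq0 // => c /s0 /= /negPn /eqP.
have [w' Mw' e] := GM _ (Gs _ cs); exists w' => //.
move: nz; rewrite e -mcoeff_msupp (perm_mem (msuppMX _ _)) => /mapP[w'' _ ->].
exact: lem_addr.
Qed.

Lemma ideal_genX (G : {mpoly K[n]} -> Prop) w' w :
  G 'X_[w'] -> (w' <= w)%MM -> ideal_gen G 'X_[w].
Proof.
move=> Gw' /submK <-; rewrite mpolyXD.
exact/ideal_genM/ideal_gen_in.
Qed.

(* Each generator X^(m i) is a multiple of a squarefree monomial of I, itself
   a multiple of some X^(m j); minimality forces i = j and equality. *)
Lemma minimal_generators_squarefree q (I : {mpoly K[n]} -> Prop)
    (m : 'I_q -> 'X_{1..n}) i :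
  squarefree_monomial_ideal I -> minimal_monomial_generators I m ->
  squarefree_mnm (m i).
Proof.
move=> [M [Msf genM]] [genm minm].
have Im j : I 'X_[m j] by apply/genm/ideal_gen_in; exists j.
have [w Mw le_wi] : exists2 w, M w & (w <= m i)%MM.
  by apply: ideal_genX_dvd ((genM _).1 (Im i)).
have /(genm _).1 Iw : I 'X_[w] by apply/genM/ideal_gen_in; exists w.
have [_ [j ->] le_jw] :
    exists2 w', (exists j, w' = m j) & (w' <= w)%MM.
  apply: ideal_genX_dvd Iw => _ [j ->]; exists (m j) => //; by exists j.
have [eji|nji] := eqVneq j i.
  move=> x; rewrite eji in le_jw.
  exact: leq_trans (mnm_lepP le_jw x) (Msf _ Mw x).
case: (minm i) => p; split=> [/genm|Hp]; last first.
  apply/genm; apply: ideal_gen_sub Hp => _ [k _ ->].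
  by apply: ideal_gen_in; exists k.
apply: ideal_gen_sub => _ [k ->]; have [->|nki] := eqVneq k i.
  by apply: (@ideal_genX _ (m j)); [exists j | apply: lepm_trans le_wi].
by apply: ideal_gen_in; exists k.
Qed.

End MonomialIdealMembership.

(** * From exponent vectors in the [T_i] to sequences of facets *)

Section WalkOfMonomial.
Variables (n q : nat) (m : 'I_q -> 'X_{1..n}).
Hypothesis sqfree : forall i, squarefree_mnm (m i).

(** The x-part of the image of [T^u] in the Rees algebra; its t-part has exponent [mdeg u]. *)
Definition mnm_weight (u : 'X_{1..q}) : 'X_{1..n} :=
  (\sum_i m i *+ u i)%MM.

Lemma mnm_weightD u v : mnm_weight (u + v) = (mnm_weight u + mnm_weight v)%MM.
Proof.
apply/mnmP => x; rewrite mnmDE !mnm_sumE -big_split; apply: eq_bigr => i _.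
by rewrite !mulmnE mnmDE mulnDr.
Qed.

Lemma mnm_weight1 i : mnm_weight U_(i) = m i.
Proof.
apply/mnmP => x; rewrite mnm_sumE (bigD1 i) //= big1 ?addn0.
  by rewrite mulmnE mnm1E eqxx muln1.
by move=> j ji; rewrite mulmnE mnm1E eq_sym (negPf ji) muln0.
Qed.

Lemma count_m2s (u : 'X_{1..q}) (P : pred 'I_q) :
  count P (m2s u) = (\sum_i P i * u i)%N.
Proof.
rewrite /m2s count_flatten sumnE !big_map.
by apply: eq_bigr => i _; rewrite count_nseq.
Qed.

Lemma mem_m2s (u : 'X_{1..q}) i : (i \in m2s u) = (u i != 0)%N.
Proof.
have /mnmP/(_ i) := s2mK u; rewrite mnmE => <-.
by rewrite -has_pred1 has_count lt0n.
Qed.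

Lemma mem_facet i x : (x \in facet m i) = m i x :> nat.
Proof.
rewrite inE lep1mP; have := sqfree i x.
by case: (m i x) => [|[|]].
Qed.

(** [m2s u] lists each index [i] with multiplicity [u i] in increasing order, so vectors [u] of
    degree [s] become weakly increasing [s]-tuples. *)
Definition mnm_tuple s (u : 'X_{1..q}) (us : mdeg u = s) : s.-tuple 'I_q :=
  Tuple (introT eqP (etrans (size_m2s u) us)).

(** By squarefreeness [m i x] is 0 or 1, so counting facets through [x] amounts to adding
    exponents. *)
Lemma deg_mnm_tuple s (u : 'X_{1..q}) (us : mdeg u = s) x :
  deg (facet m) (mnm_tuple us) x = mnm_weight u x.
Proof.
rewrite /deg count_m2s mnm_sumE; apply: eq_bigr => i _.
by rewrite mem_facet mulmnE.
Qed.

Lemma index_seq_mnm_tuple s (u : 'X_{1..q}) (us : mdeg u = s) :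
  index_seq (mnm_tuple us).
Proof. by have := srt_m2s u; rewrite sorted_map. Qed.

Lemma not_walk_exchange (u v : 'X_{1..q}) (a b : 'X_{1..n}) :
  ~ contains_simplicial_even_walk (facet m) ->
  mdeg u = mdeg v -> (1 < mdeg u)%N ->
  (a + mnm_weight u = b + mnm_weight v)%MM ->
  exists i j, [/\ u i != 0%N, v j != 0%N &
    (m i - m j <= b)%MM \/ (m j - m i <= a)%MM].
Proof.
move=> nowalk uv u2 /mnmP eqw.
pose al := mnm_tuple uv; pose be := mnm_tuple (erefl (mdeg v)).
(* The walk condition at one pair, in boolean form, so that its failure yields explicit indices [i]
   and [j]. *)
pose ok i j :=
  ~~ (facet m i :\: facet m j \subset
        [set x in vertices (facet m) |
          (deg (facet m) be x < deg (facet m) al x)%N]) &&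
  ~~ (facet m j :\: facet m i \subset
        [set x in vertices (facet m) |
          (deg (facet m) al x < deg (facet m) be x)%N]).
have [/allP all_ok|] := boolP (all (fun i => all (ok i) be) al).
  case: nowalk; exists (mdeg v), al, be.
  split; [by rewrite -uv | exact: index_seq_mnm_tuple.. |].
  by move=> i j /all_ok /allP /[apply] /andP[].
case/allPn => i i_al /allPn[j j_be]; rewrite /ok negb_and !negbK => sub.
rewrite mem_m2s in i_al; rewrite mem_m2s in j_be.
exists i, j; split=> //.
have mi := sqfree i; have mj := sqfree j.
(* The truncated [m i x - m j x] is 1 on [F_i] minus [F_j] and 0 elsewhere. Where it is 1, [u] has
   larger weight than [v], so the equality of images forces [b x] to be positive. The other case is
   symmetric, with [a]. *)
case/orP: sub => /subsetP sub; [left | right]; apply/mnm_lepP => x.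
all: move: (mi x) (mj x) (sub x) (eqw x).
all: rewrite mnmBE !mnmDE !inE !deg_mnm_tuple !lep1mP.
all: case: (m i x) => [|[|k]] //; case: (m j x) => [|[|l]] //= _ _.
all: by move=> /(_ isT) /andP[_]; lia.
Qed.

End WalkOfMonomial.

(** * Congruence of monomials modulo the linear part *)

Section LinearType.
Variables (K : fieldType) (n q : nat) (m : 'I_q -> 'X_{1..n}).

Local Notation R := {mpoly K[n]}.
Local Notation f := (fun i => 'X_[m i] : R).

Definition bimonomial (a : 'X_{1..n}) (u : 'X_{1..q}) : {mpoly R[q]} :=
  'X_[a] *: 'X_[u].

Definition linear_ideal : {mpoly R[q]} -> Prop :=
  ideal_gen (fun p : {mpoly R[q]} => defining_ideal f p /\ p \is 1.-homog).

Lemma bimonomialM a b u v :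
  bimonomial a u * bimonomial b v = bimonomial (a + b) (u + v).
Proof. by rewrite /bimonomial -scalerAl -scalerAr scalerA -!mpolyXD. Qed.

Lemma rees_map_bimonomial a u :
  rees_map f (bimonomial a u) =
  ('X_[a + mnm_weight m u])%:P * 'X^(mdeg u).
Proof.
rewrite /rees_map mmapZ mmapX /mmap1 mpolyXD polyCM -mulrA; congr (_ * _).
under eq_bigr do rewrite exprMn -rmorphXn.
rewrite big_split /= -rmorph_prod /= mprodXnE; congr (_ * _).
by rewrite prodrXr -mdegE.
Qed.

Lemma linear_bimonomial a b u v : mdeg u = 1%N -> mdeg v = 1%N ->
  (a + mnm_weight m u = b + mnm_weight m v)%MM ->
  linear_ideal (bimonomial a u - bimonomial b v).
Proof.
move=> u1 v1 e; apply: ideal_gen_in; split.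
  by rewrite /defining_ideal /rees_map mmapB -!/(rees_map _ _)
    !rees_map_bimonomial e u1 v1 subrr.
by apply: rpredB; apply: dhomogZ; rewrite dhomogX; apply/eqP.
Qed.

Lemma linear_ideal_sym p1 p2 :
  linear_ideal (p1 - p2) -> linear_ideal (p2 - p1).
Proof. by move/ideal_genN; rewrite opprB. Qed.

Lemma linear_ideal_trans p2 p1 p3 :
  linear_ideal (p1 - p2) -> linear_ideal (p2 - p3) -> linear_ideal (p1 - p3).
Proof. by move=> h1 /(ideal_genD h1); rewrite addrA subrK. Qed.

Lemma linear_bimonomialD a b c u v w :
  linear_ideal (bimonomial a u - bimonomial b v) ->
  linear_ideal (bimonomial (c + a) (w + u) - bimonomial (c + b) (w + v)).
Proof. by move/(ideal_genM (bimonomial c w)); rewrite mulrBr !bimonomialM. Qed.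

(* Multiplies x^(m i \ m j) T_j - x^(m j \ m i) T_i, a linear element of the
   defining ideal ([-] on multinomials is truncated), by a monomial. *)
Lemma linear_exchange i j b (v : 'X_{1..q}) :
  v j != 0%N -> (m i - m j <= b)%MM ->
  exists b' v', [/\ (b + mnm_weight m v = b' + mnm_weight m (U_(i) + v'))%MM,
    mdeg v = (mdeg v').+1 &
    linear_ideal (bimonomial b v - bimonomial b' (U_(i) + v'))].
Proof.
rewrite -lep1mP => /submK ev /submK eb.
have e : ((m i - m j) + mnm_weight m U_(j) =
          (m j - m i) + mnm_weight m U_(i))%MM.
  by rewrite !mnm_weight1; apply/mnmP => x; rewrite !mnmDE !mnmBE; lia.
exists ((b - (m i - m j)) + (m j - m i))%MM, (v - U_(j))%MM; split.
- rewrite -{1}ev -{1}eb !mnm_weightD.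
  apply/mnmP => x; have /mnmP/(_ x) := e; rewrite !mnmDE; lia.
- by rewrite -{1}ev mdegD mdeg1 addn1.
- rewrite -{1}ev -{1}eb [(U_(i) + _)%MM]addmC.
  by apply/linear_bimonomialD/linear_bimonomial; rewrite ?mdeg1.
Qed.

Hypothesis sqfree : forall i, squarefree_mnm (m i).
Hypothesis nowalk : ~ contains_simplicial_even_walk (facet m).

Lemma linear_same_image a b u v : mdeg u = mdeg v ->
  (a + mnm_weight m u = b + mnm_weight m v)%MM ->
  linear_ideal (bimonomial a u - bimonomial b v).
Proof.
have [s] := ubnP (mdeg u); elim: s => // s IH in a b u v *.
rewrite ltnS => us uv e.
(* A common factor [T_i] contributes [m i] to both images; cancelling it leaves monomials of smaller
   degree, to which [IH] applies. *)
have common i a' b' u' v' : mdeg u' = mdeg v' -> (mdeg u' < s)%N ->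
    (a' + mnm_weight m (U_(i) + u') = b' + mnm_weight m (U_(i) + v'))%MM ->
    linear_ideal (bimonomial a' (U_(i) + u') - bimonomial b' (U_(i) + v')).
  move=> uv' us' e'; rewrite -[a']add0m -[b']add0m.
  apply/linear_bimonomialD/IH => //; apply: (@addmI _ (m i)).
  by rewrite addmA (addmC (m i)) addmA (addmC (m i)) -!addmA -(mnm_weight1 m i)
    -!mnm_weightD.
(* Exchanging [T_j] for [T_i] in the second monomial makes [T_i] a common factor. *)
have step i j a' b' (u' v' : 'X_{1..q}) : u' i != 0%N -> v' j != 0%N ->
    (m i - m j <= b')%MM -> mdeg u' = mdeg v' -> (mdeg u' <= s)%N ->
    (a' + mnm_weight m u' = b' + mnm_weight m v')%MM ->
    linear_ideal (bimonomial a' u' - bimonomial b' v').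
  move=> ui vj le_b uv' us' e'.
  have [b2 [v2 [e2 dv2 lv2]]] := linear_exchange vj le_b.
  apply: linear_ideal_trans (linear_ideal_sym lv2).
  move: ui; rewrite -lep1mP => /submK; rewrite addmC => eu.
  have du' : mdeg u' = (mdeg (u' - U_(i))).+1.
    by rewrite -{1}eu mdegD mdeg1.
  rewrite -eu; apply: common; first by move: uv'; rewrite du' dv2 => -[].
    by rewrite du' in us'.
  by rewrite eu e' e2.
(* Walks have length at least 2, so low degrees are separate: in degree 0 the two monomials
   coincide, and in degree 1 their difference is itself a linear generator. *)
have [u0|u1|u2] := ltngtP (mdeg u) 1.
- move: u0; rewrite ltnS leqn0 => /eqP u0.
  have /eqP v0 : mdeg v == 0%N by rewrite -uv u0.
  move/eqP: u0 v0 e; rewrite mdeg_eq0 => /eqP -> /eqP; rewrite mdeg_eq0.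
  by move=> /eqP -> /addIm ->; rewrite subrr; apply: ideal_gen0.
- have [i [j [ui vj [le_b|le_a]]]] := not_walk_exchange sqfree nowalk uv u1 e.
    exact: (step i j).
  apply: linear_ideal_sym; apply: (step j i) => //; by rewrite -uv.
- apply: linear_bimonomial => //; by rewrite -uv.
Qed.

Lemma defining_ideal_linear p : defining_ideal f p -> linear_ideal p.
Proof.
pose t := [seq (a, u) | u <- msupp p, a <- msupp p@_u].
pose c (k : 'X_{1..n} * 'X_{1..q}) : K := p@_k.2@_k.1.
pose image (k : 'X_{1..n} * 'X_{1..q}) := ((k.1 + mnm_weight m k.2)%MM, mdeg k.2).
(* The first monomial of [t] with image [z]; the default of [nth] is never reached when [z] is the
   image of an entry of [t]. *)
pose rep z := nth (0%MM, 0%MM) t (index z [seq image k | k <- t]).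
have imageK k : k \in t -> image (rep (image k)) = image k.
  move=> kt; have kt' := map_f image kt.
  rewrite /rep -(nth_map _ (image (0%MM, 0%MM))) ?nth_index //.
  by rewrite -(size_map image) index_mem.
have pE : p = \sum_(k <- t) (c k)%:MP *: bimonomial k.1 k.2.
  rewrite big_allpairs_dep {1}[p]mpolyE; apply: eq_bigr => u _ /=.
  rewrite {1}[p@_u]mpolyE scaler_suml; apply: eq_bigr => a _.
  by rewrite scalerA mul_mpolyC.
move=> Jp.
(* This sum is the coefficient of [x^w t^d], for [z = (w, d)], in the image of [p], which
   vanishes. *)
have sum0 z : \sum_(k <- t | image k == z) c k = 0.
  have /(congr1 (fun P : {poly R} => P`_z.2@_z.1)) := Jp.
  rewrite coef0 mcoeff0 {1}pE /rees_map raddf_sum coef_sum raddf_sum /= => e0.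
  rewrite -[RHS]e0 big_mkcond; apply: eq_bigr => k _.
  rewrite mmapZ -/(rees_map f _) rees_map_bimonomial mulrA -polyCM.
  rewrite coefCM coefXn mulr_natr mcoeffMn mcoeffCM mcoeffX.
  case: z {e0} => w d /=; rewrite xpair_eqE [d == _]eq_sym.
  by do 2!case: eqP => _ //=; rewrite ?mulr1 ?mulr0 ?mul0rn.
(* Moving each term to the representative of its fiber leaves one monomial per fiber, with
   coefficient zero by [sum0]. Subtracting this sum writes [p] through differences of monomials with
   equal image. *)
have rep0 : \sum_(k <- t)
    (c k)%:MP *: bimonomial (rep (image k)).1 (rep (image k)).2 = 0.
  rewrite (sum_fibers image) big1 // => z _.
  rewrite (eq_bigr (fun k => (c k)%:MP *: bimonomial (rep z).1 (rep z).2)).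
    by rewrite -scaler_suml -raddf_sum sum0 raddf0 scale0r.
  by move=> k /eqP ->.
rewrite -[p]subr0 -rep0 {1}pE -sumrB.
apply: ideal_gen_sum => k kt; rewrite -scalerBr -mul_mpolyC.
have /esym imgk := imageK k kt; apply/ideal_genM/linear_same_image.
  exact: (congr1 snd imgk).
exact: (congr1 fst imgk).
Qed.

Lemma linear_ideal_defining p : linear_ideal p -> defining_ideal f p.
Proof.
move=> [s [Gs ->]]; rewrite /defining_ideal /rees_map raddf_sum big_seq big1 //.
move=> c /Gs [Jc _] /=; rewrite rmorphM /=.
by rewrite [X in _ * X]Jc mulr0.
Qed.

End LinearType.

Theorem theorem4p4 (K : fieldType) (n q : nat)
    (I : {mpoly K[n]} -> Prop) (m : 'I_q -> 'X_{1..n}) :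
  squarefree_monomial_ideal I ->
  minimal_monomial_generators I m ->
  ~ contains_simplicial_even_walk (facet m) ->
  linear_type (fun i => 'X_[m i] : {mpoly K[n]}).
Proof.
move=> Isf Imin nowalk p; split; last exact: linear_ideal_defining.
apply: defining_ideal_linear nowalk p => i.
exact: minimal_generators_squarefree Isf Imin.
Qed.
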